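(* Let $X_1,X_2,\ldots$ be i.i.d. real-valued random variables with common distribution function $F(x)=P(X_1\le x)$, for $n\ge 1$ let $F_n$ be the empirical distribution function of $X_1,\ldots,X_n$, and let $p\in[0,1]$. Then the following hold. (a) Suppose $rq_F(p)=lq_F(p)$. Then, as $n\to\infty$, \[rq_{F_n}(p)\to rq_F(p)\quad\text{a.s.}\qquad\text{and}\qquad lq_{F_n}(p)\to lq_F(p)\quad\text{a.s.}\] (b) When $lq_F(p)<rq_F(p)$, both sequences $(rq_{F_n}(p))_{n\ge1}$ and $(lq_{F_n}(p))_{n\ge1}$ diverge (i.e. do not converge) almost surely. (c) Suppose $lq_F(p)<rq_F(p)$. Then, almost surely, for every $\epsilon>0$ there exists $N$ such that for all $n>N$, \[lq_{F_n}(p),\ rq_{F_n}(p)\ \in\ (lq_F(p)-\epsilon,\ lq_F(p)]\cup[rq_F(p),\ rq_F(p)+\epsilon).\] (d) Almost surely, \[\limsup_{n\to\infty} lq_{F_n}(p)=\limsup_{n\to\infty} rq_{F_n}(p)=rq_F(p)\] and \[\liminf_{n\to\infty} lq_{F_n}(p)=\liminf_{n\to\infty} rq_{F_n}(p)=lq_F(p).\]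
   Context: For a distribution function $G$ on $\mathbb{R}$ and $p\in[0,1]$, the left quantile is $lq_G(p)=\inf\{x : G(x)\ge p\}$ and the right quantile is $rq_G(p)=\inf\{x : G(x)>p\}=\sup\{x : G(x)\le p\}$, with the usual conventions $\inf\emptyset=+\infty$, $\sup\emptyset=-\infty$, $\inf\mathbb{R}=-\infty$, $\sup\mathbb{R}=+\infty$. The empirical distribution function is $F_n(x)=\frac1n\#\{i\le n : X_i\le x\}$; thus $lq_{F_n}(p)$ and $rq_{F_n}(p)$ are the left and right sample quantiles, which are random.
   Formalization: For lq_F(p)<rq_F(p), (b) and in (d) limsup lq_{F_n}=rq_F, liminf rq_{F_n}=lq_F are claimed only for 0<p<1: they fail at p=0,1 (X_i=0, p=0: rq_{F_n}(0)=0 converges, lq_{F_n}(0)=-∞). In (c) an infinite closed endpoint counts as in its interval, else (c) fails at p=0,1. *)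

(* Defs.v *)
From HB Require Import structures.
From mathcomp Require Import all_boot all_order all_algebra finmap.
From mathcomp Require Import all_classical all_reals all_analysis.

Set Implicit Arguments.
Unset Strict Implicit.
Unset Printing Implicit Defensive.

Import Order.TTheory GRing.Theory Num.Theory.
Import numFieldNormedType.Exports.

Local Open Scope classical_set_scope.
Local Open Scope ring_scope.

(* Distribution functions are taken with values in \bar R, to match the
   library's [cdf]. *)
Section Quantiles.
Context {R : realType}.
Implicit Types (G : R -> \bar R) (p : R).

Definition lq G p : \bar R :=
  ereal_inf [set x%:E | x in [set x : R | (p%:E <= G x)%E]].

Definition rq G p : \bar R :=
  ereal_inf [set x%:E | x in [set x : R | (p%:E < G x)%E]].

(* For finite a these are the intervals ]a - e, a] and [a, a + e[.  When a is
   infinite, a - e = a = a + e in \bar R and those intervals are empty; the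
   closed end a is kept nevertheless. *)
Definition left_window (a : \bar R) (e : R) : set (\bar R) :=
  `](a - e%:E)%E, a] `|` [set a].

Definition right_window (a : \bar R) (e : R) : set (\bar R) :=
  `[a, (a + e%:E)%E[ `|` [set a].

End Quantiles.

Section Samples.
Context {d : measure_display} {T : measurableType d} {R : realType}.
Context {P : probability T R}.
Implicit Type X : nat -> {RV P >-> R}.

(* Mutual independence: the product rule for every finite subfamily. *)
Definition independent_RVs X : Prop :=
  forall (J : {fset nat}) (B : nat -> set R),
    (forall i, measurable (B i)) ->
    P (\bigcap_(i in [set` J]) X i @^-1` B i) =
    (\prod_(i <- J) P (X i @^-1` B i))%E.

Definition identically_distributed X : Prop :=
  forall (i j : nat) (B : set R), measurable B ->
    distribution P (X i) B = distribution P (X j) B.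

Definition iid X : Prop := independent_RVs X /\ identically_distributed X.

(* The sample of size n is X 0, ..., X n.-1.  For n = 0 this is the constant 0
   (since 0^-1 = 0), a value that has no effect on the behaviour as n grows. *)
Definition empirical_cdf X (n : nat) (t : T) (x : R) : \bar R :=
  (#|[set i : 'I_n | X i t <= x]%SET|%:R / n%:R)%:E.

End Samples.

(* Main.v *)
Require Import Defs.
From HB Require Import structures.
From mathcomp Require Import all_boot all_order all_algebra finmap.
From mathcomp Require Import all_classical all_reals all_analysis.
From mathcomp Require Import ring lra.
Import Order.TTheory GRing.Theory Num.Theory.
Import numFieldNormedType.Exports.
Local Open Scope classical_set_scope.
Local Open Scope ring_scope.

(** Write [a] and [b] for the left and right [p]-quantiles of the distribution
function [F], and [Fn] for the empirical one.  A quantile is the infimum of the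
up-closed set of reals where a distribution function is at least (or exceeds)
[p], so every assertion about sample quantiles is an assertion about the sign
of [Fn x - p] at fixed points [x], that is, about the sign of a random walk
whose steps are i.i.d. centred Bernoulli variables, possibly with a drift.

- Outside the interval from [a] to [b] the walk has a drift: [F x < p] below
  [a] and [F x > p] above [b].  Chernoff's bound makes the
  probability of the wrong sign at time [n] decay geometrically, and
  Borel-Cantelli gives the right sign from some time on
  ([ae_eventually_few_hits]).  Over the countably many rational [x] this
  confines the sample quantiles eventually to any neighbourhood of that
  interval ([ae_lt_lq], [ae_gt_rq]), which settles everything when [a = b].

- If [a < b] then [F = p] on the open interval between them, so almost surely
  no observation falls there, [Fn] is constant there, and no sample quantile
  lies strictly between [a] and [b].  On which side it lies is decided by the
  sign of [Fn x0 - p] at any one point [x0] of the gap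
  ([ae_quantiles_avoid_gap]); this is the content of the windows in (c).

- At such an [x0] the walk is centred.  For [0 < p < 1] it almost surely takes
  both signs infinitely often ([ae_often_many_hits], applied to a half-line and
  to its complement), so the sample quantiles keep jumping across the gap and
  their upper and lower limits are [b] and [a].  At [p = 0] and [p = 1] the walk
  is almost surely constantly zero, which still gives the weak inequalities
  infinitely often, hence the first two equalities of (d).

Parts (a) and (b) then follow from (d), since a sequence in the extended reals
converges exactly when its lower and upper limits agree.

Recurrence of the centred walk uses no limit theorem.  The probability
[stay_prob q n s] of remaining nonpositive during [n] steps from height [s]
satisfies a one-step recursion, and is compared with the linear function
[e * (1 - s)], which is harmonic for the walk and, since steps up are at most
one, nonnegative at every point the walk can reach up to its first positive
value.  A maximum-principle argument shows that the excess over this function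
shrinks by a constant factor every [L] steps ([stay_prob_contract]); letting
[e] tend to zero, the probability of remaining nonpositive forever vanishes. *)

(** * Finite sequences of independent Bernoulli trials *)

(** Expectation of [f] over words of [n] independent Bernoulli([q]) letters,
expanded along the first letter so that one-step recursions hold by
computation. *)
Fixpoint bern_mean {R : realType} (q : R) (n : nat) (f : seq bool -> R) : R :=
  if n is m.+1 then
    q * bern_mean q m (f \o cons true) + (1 - q) * bern_mean q m (f \o cons false)
  else f [::].

Lemma bern_mean_le {R : realType} (q : R) n (f g : seq bool -> R) :
  0 <= q <= 1 -> (forall w, size w = n -> f w <= g w) ->
  bern_mean q n f <= bern_mean q n g.
Proof.
move=> q01; elim: n f g => [|n IHn] f g fg /=; first exact: fg.
case/andP: q01 => q0 q1; rewrite lerD// ler_wpM2l ?subr_ge0//;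
  by apply: IHn => w sw; apply: fg; rewrite /= sw.
Qed.

Lemma bern_mean_ext {R : realType} (q : R) n (f g : seq bool -> R) :
  (forall w, size w = n -> f w = g w) -> bern_mean q n f = bern_mean q n g.
Proof.
elim: n f g => [|n IHn] f g fg /=; first exact: fg.
by congr (_ * _ + _ * _); apply: IHn => w sw; apply: fg; rewrite /= sw.
Qed.

Lemma bern_mean_cst {R : realType} (q c : R) n : bern_mean q n (fun=> c) = c.
Proof. by elim: n => //= n; rewrite /comp => ->; ring. Qed.

Lemma bern_meanZ {R : realType} (q c : R) n f :
  bern_mean q n (fun w => c * f w) = c * bern_mean q n f.
Proof. by elim: n f => //= n IHn f; rewrite /comp !IHn; ring. Qed.

Lemma bern_mean_cat {R : realType} (q : R) m n f :
  bern_mean q (m + n) f =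
  bern_mean q m (fun w => bern_mean q n (fun v => f (w ++ v))).
Proof. by elim: m f => //= m IHm f; rewrite !IHm. Qed.

(** Probability generating function of the binomial distribution. *)
Lemma bern_mean_pgf {R : realType} (q z : R) n :
  bern_mean q n (fun w => z ^+ count id w) = (1 - q + q * z) ^+ n.
Proof.
elim: n => [|n IHn] /=; first by rewrite !expr0.
rewrite (@bern_mean_ext _ _ _ (_ \o cons true) (fun w => z * z ^+ count id w)).
  rewrite bern_meanZ.
  rewrite (@bern_mean_ext _ _ _ (_ \o cons false) (fun w => z ^+ count id w)) //.
  by rewrite !IHn exprS; ring.
by move=> w _ /=; rewrite add1n exprS.
Qed.

(** The two sides agree at [h = 0], where their derivatives are [q] and [p].
The explicit [h] comes from [1 + x <= expR x] alone, which bounds the left side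
through [expR h <= (1 - h)^-1]: what remains is [q < p * (1 - h)]. *)
Lemma chernoff_rate {R : realType} (q p : R) : 0 <= q -> q < p ->
  exists2 h : R, 0 < h & 1 - q + q * expR h < expR (p * h).
Proof.
move=> q0 qp; have p0 : 0 < p by lra.
pose h := (p - q) / (2 * p).
have hE : h * (2 * p) = p - q by rewrite /h; field; lra.
have h0 : 0 < h by rewrite divr_gt0; lra.
have h1 : h < 1 by nra.
exists h => //.
have : 1 + p * h <= expR (p * h) by exact: expR_ge1Dx.
suff : 1 - q + q * expR h < 1 + p * h by lra.
have : expR h <= (1 - h)^-1.
  rewrite -[leLHS]invrK lef_pV2 ?posrE; [|by rewrite invr_gt0 expR_gt0|lra].
  by rewrite -expRN expR_ge1Dx.
move=> ez; have [E|E] : q = 0 \/ 0 < q by lra.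
  by rewrite E mul0r; nra.
suff : q * (1 - h)^-1 < q + p * h by nra.
rewrite ltr_pdivrMr; last lra.
suff : 0 < h * (p - q - p * h) by lra.
by apply: mulr_gt0 => //; nra.
Qed.

(** Chernoff's bound: the indicator is at most the ratio of
[expR (h * count)] to [expR (h * p * n)]. *)
Lemma bern_mean_chernoff {R : realType} (q p : R) : 0 <= q <= 1 -> q < p ->
  exists2 r : R, 0 <= r < 1 & forall n,
    bern_mean q n (fun w => (p * n%:R <= (count id w)%:R)%R%:R) <= r ^+ n.
Proof.
move=> /andP[q0 q1] qp; have [h h0 hr] := chernoff_rate q p q0 qp.
have y0 := expR_gt0 (p * h); have z0 := expR_gt0 h.
exists ((1 - q + q * expR h) / expR (p * h)).
  apply/andP; split; last by rewrite ltr_pdivrMr// mul1r.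
  by apply: divr_ge0; [rewrite addr_ge0 ?mulr_ge0 ?subr_ge0//|]; exact: ltW.
move=> n; rewrite expr_div_n [leRHS]mulrC -bern_mean_pgf -bern_meanZ.
apply: bern_mean_le => [|w _]; first by rewrite q0.
rewrite -!expRM_natl -expRN -expRD.
have [hw|_] := leP (p * n%:R) (count id w)%:R; last exact: expR_ge0.
rewrite -[leLHS]expR0 ler_expR addrC subr_ge0 mulrCA mulrA.
by apply: ler_wpM2r; first exact: ltW.
Qed.

(** * The centred Bernoulli walk does not stay nonpositive *)

(** The walk starts at [s] and moves by [1 - q] or by [- q]; both endpoints of
the word are tested. *)
Fixpoint stays {R : realType} (q s : R) (w : seq bool) : bool :=
  (s <= 0) && (if w is b :: w' then stays q (s + b%:R - q) w' else true).

Lemma staysP {R : realType} (q s : R) w :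
  (forall k, (k <= size w)%N -> s + (count id (take k w))%:R - q * k%:R <= 0) ->
  stays q s w.
Proof.
elim: w s => [|b w IHw] s H /=.
  by have := H 0%N erefl; rewrite /= mulr0 subr0 addr0 => ->.
have := H 0%N erefl; rewrite /= mulr0 subr0 addr0 => -> /=.
apply: IHw => k kw; apply: le_trans (H k.+1 kw).
by rewrite /= natrD -natr1; case: b {H} => /=; lra.
Qed.

Definition stay_prob {R : realType} (q : R) n (s : R) : R :=
  bern_mean q n (fun w => (stays q s w)%:R).

Lemma stay_prob_pos_start {R : realType} (q : R) n s : 0 < s -> stay_prob q n s = 0.
Proof.
move=> s0; rewrite -[RHS](bern_mean_cst q 0 n); apply: bern_mean_ext => w _.
by case: w => [|b w] /=; rewrite leNgt s0.
Qed.

Lemma stay_probS {R : realType} (q : R) n s : s <= 0 ->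
  stay_prob q n.+1 s =
  q * stay_prob q n (s + 1 - q) + (1 - q) * stay_prob q n (s - q).
Proof.
move=> s0; rewrite /stay_prob /=; congr (_ * _ + _ * _);
  by apply: bern_mean_ext => w _ /=; rewrite s0 ?addr0.
Qed.

Lemma stay_prob_le1 {R : realType} (q : R) n s : 0 <= q <= 1 ->
  stay_prob q n s <= 1.
Proof.
move=> q01; rewrite -[leRHS](bern_mean_cst q 1 n); apply: bern_mean_le => // w _.
by case: stays.
Qed.

(** Maximum principle.  The linear function [e * (1 - s)] is harmonic for the
walk, and it bounds [stay_prob] by itself when [s <= - L * (1 - q)], where it
exceeds one.  From any other [s], the run of at most [L] steps up, of
probability at least [q ^+ L], leads to a positive height, where [stay_prob]
vanishes; only the complementary event contributes to the excess [c]. *)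
Lemma stay_prob_contract {R : realType} (q e c : R) (N L : nat) :
  0 < q < 1 -> 0 < e -> 0 <= c -> e^-1 < L%:R * (1 - q) ->
  (forall n s, (N <= n)%N -> s <= 1 -> stay_prob q n s <= e * (1 - s) + c) ->
  forall n s, (N + L <= n)%N -> s <= 1 ->
    stay_prob q n s <= e * (1 - s) + (1 - q ^+ L) * c.
Proof.
move=> /andP[q0 q1] e0 c0 hL H.
have q01 : 0 <= q <= 1 by rewrite !ltW.
have step j n s : (N + j <= n)%N -> s <= 1 -> 0 < s + j%:R * (1 - q) ->
    stay_prob q n s <= e * (1 - s) + (1 - q ^+ j) * c.
  have rhs0 i x : x <= 1 -> 0 <= e * (1 - x) + (1 - q ^+ i) * c.
    move=> x1; rewrite addr_ge0// mulr_ge0 ?subr_ge0//; first exact: ltW.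
    by rewrite exprn_ile1 ?ltW.
  elim: j n s => [|j IHj] n s.
    by move=> _ s1; rewrite mul0r addr0 => s0; rewrite stay_prob_pos_start// rhs0.
  move=> + s1 hs; have [s0|s0] := ltP 0 s; first by rewrite stay_prob_pos_start// rhs0.
  case: n => [|n Njn]; first by rewrite addnS.
  rewrite addnS ltnS in Njn; rewrite stay_probS//.
  have A : stay_prob q n (s + 1 - q) <= e * (1 - (s + 1 - q)) + (1 - q ^+ j) * c.
    by apply: IHj => //; [lra|rewrite -natr1 in hs; lra].
  have B : stay_prob q n (s - q) <= e * (1 - (s - q)) + c.
    by apply: H; [exact: leq_trans (leq_addr _ _) Njn|lra].
  have {}A := ler_wpM2l (ltW q0) A.
  have {}B : (1 - q) * stay_prob q n (s - q) <= (1 - q) * (e * (1 - (s - q)) + c).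
    by rewrite ler_wpM2l // subr_ge0 ltW.
  by rewrite exprS; lra.
move=> n s Nn s1; have [hs|hs] := ltP 0 (s + L%:R * (1 - q)); first exact: step.
apply: (le_trans (stay_prob_le1 q n s q01)).
have : 1 <= e * (1 - s).
  by rewrite -ler_pdivrMl// mulr1; lra.
suff : 0 <= (1 - q ^+ L) * c by lra.
by rewrite mulr_ge0 // subr_ge0 exprn_ile1 ?ltW.
Qed.

(** Iterating the contraction kills the excess, and the slope of the linear
bound is chosen small against the depth [m]. *)
Lemma stay_prob_small {R : realType} (q m e : R) : 0 < q < 1 -> 0 <= m -> 0 < e ->
  exists N, forall s, - m <= s <= 1 -> stay_prob q N s <= e.
Proof.
move=> q01 m0 e0; have [q0 q1] := andP q01.
have q01' : 0 <= q <= 1 by rewrite !ltW.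
(* half of [e] is left for the linear bound on [[- m, 1]] *)
pose e' := e / (2 * (1 + m)).
have e'0 : 0 < e' by rewrite divr_gt0//; lra.
have e'E : e' * (1 + m) = e / 2 by rewrite /e'; field; lra.
have [L hL] : exists L : nat, e'^-1 < L%:R * (1 - q).
  (* enough steps up to climb from depth [e'^-1] to a positive height *)
  exists (Num.trunc (e'^-1 / (1 - q))).+1.
  by rewrite -ltr_pdivrMr ?subr_gt0// truncnS_gt.
pose r := 1 - q ^+ L.
have r01 : 0 <= r < 1.
  rewrite /r subr_ge0 exprn_ile1 ?ltW//= ltrBlDr ltrDl exprn_gt0//.
have [r0 r1] := andP r01.
have iter k n s : (k * L <= n)%N -> s <= 1 ->
    stay_prob q n s <= e' * (1 - s) + r ^+ k.
  elim: k n s => [|k IHk] n s hn s1.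
    rewrite expr0; apply: (le_trans (stay_prob_le1 q n s q01')).
    by rewrite lerDr mulr_ge0 ?subr_ge0// ltW.
  rewrite exprS; apply: (stay_prob_contract q e' (r ^+ k) (k * L) L) => //.
    exact: exprn_ge0.
  by rewrite addnC -mulSn.
have [k hk] : exists k, r ^+ k < e / 2.
  have : \forall n \near \oo, `|r ^+ n| < e / 2.
    apply: cvgr0_norm_lt; last lra.
    by apply: cvg_expr; rewrite ger0_norm.
  case=> k _ /(_ k (leqnn _)) /= hk.
  by exists k; rewrite -[_ ^+ _]ger0_norm // exprn_ge0.
exists (k * L)%N => s /andP[ms s1]; apply: (le_trans (iter k _ s (leqnn _) s1)).
have : e' * (1 - s) <= e' * (1 + m) by apply: ler_wpM2l; [exact: ltW|lra].
lra.
Qed.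

(** * Hits of a Borel set by an i.i.d. sequence *)

Definition outcomes {T : Type} {R : realType} (X : nat -> T -> R) (B : set R)
    (n : nat) (t : T) : seq bool :=
  [seq X i t \in B | i <- iota 0 n].

Lemma size_outcomes {T : Type} {R : realType} (X : nat -> T -> R) B n t :
  size (outcomes X B n t) = n.
Proof. by rewrite size_map size_iota. Qed.

Lemma outcomesS {T : Type} {R : realType} (X : nat -> T -> R) B n t :
  outcomes X B n.+1 t = rcons (outcomes X B n t) (X n t \in B).
Proof. by rewrite /outcomes -addn1 iotaD map_cat cats1. Qed.

Lemma take_outcomes {T : Type} {R : realType} (X : nat -> T -> R) B m n t :
  (m <= n)%N -> take m (outcomes X B n t) = outcomes X B m t.
Proof. by move=> mn; rewrite -map_take take_iota (minn_idPl mn). Qed.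

(** Membership as a letter: fixing the [i]-th letter of [outcomes] prescribes
that [X i] lies in [B] or in its complement, the shape of the events in the
product rule. *)
Lemma preimage_in {T : Type} {R : realType} (f : T -> R) (B : set R) (b : bool) :
  [set t | (f t \in B) = b] = f @^-1` (if b then B else ~` B).
Proof.
apply/seteqP; split => t /=; case: b => /=.
- exact: set_mem.
- by move=> tB Bt; move: tB; rewrite mem_set.
- by move=> Bt; rewrite mem_set.
- by move=> Bt; apply/negP => /set_mem.
Qed.

Lemma measurable_outcomes {d} {T : measurableType d} {R : realType}
    {P : probability T R} (X : nat -> {RV P >-> R}) (B : set R) n (A : set (seq bool)) :
  measurable B -> measurable [set t | A (outcomes X B n t)].
Proof.
move=> mB; elim: n A => [|n IHn] A.
  rewrite [X in measurable X](_ : _ = [set _ | A [::]]) //.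
  have [a|a] := pselect (A [::]).
    by rewrite [X in measurable X](_ : _ = setT) //; apply/seteqP; split.
  by rewrite [X in measurable X](_ : _ = set0) //; apply/seteqP; split.
have mX b : measurable (X n @^-1` (if b then B else ~` B)).
  by apply: measurable_funPTI; case: b => //; exact: measurableC.
rewrite [X in measurable X](_ : _ = \bigcup_(b in [set: bool])
    ([set t | A (rcons (outcomes X B n t) b)] `&` X n @^-1` (if b then B else ~` B))).
  apply: fin_bigcup_measurable => // b _; apply: measurableI => //.
  exact: (IHn [set w | A (rcons w b)]).
apply/seteqP; split => t /=.
  rewrite outcomesS => At; exists (X n t \in B) => //; split => //.
  by rewrite -preimage_in.
by move=> [b _ [At]]; rewrite -preimage_in outcomesS /= => ->.
Qed.

Lemma prob_complement {d} {T : measurableType d} {R : realType}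
    {P : probability T R} (Y : {RV P >-> R}) (B : set R) (q : R) :
  measurable B -> P (Y @^-1` B) = q%:E -> P (Y @^-1` (~` B)) = (1 - q)%:E.
Proof.
move=> mB qB; rewrite preimage_setC probability_setC ?qB //.
exact: measurable_funPTI.
Qed.

Lemma iid_prob {d} {T : measurableType d} {R : realType}
    {P : probability T R} (X : nat -> {RV P >-> R}) (B : set R) (q : R) i :
  iid X -> measurable B -> P (X 0%N @^-1` B) = q%:E -> P (X i @^-1` B) = q%:E.
Proof. by move=> [_ idX] mB <-; exact: idX. Qed.

Lemma prob_outcomes_eq {d} {T : measurableType d} {R : realType}
    {P : probability T R} (X : nat -> {RV P >-> R}) (B : set R) (q : R) (w : seq bool) :
  iid X -> measurable B -> P (X 0%N @^-1` B) = q%:E ->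
  P [set t | outcomes X B (size w) t = w] =
  (\prod_(b <- w) (if b then q else 1 - q))%:E.
Proof.
move=> iX mB qB; pose J := [fset i in iota 0 (size w)]%fset.
pose C i := if nth false w i then B else ~` B.
have mC i : measurable (C i) by rewrite /C; case: ifP => // _; exact: measurableC.
have := (proj1 iX) J C mC.
rewrite [X in P X = _](_ : _ = [set t | outcomes X B (size w) t = w]).
  move=> ->; rewrite (perm_big (iota 0 (size w))); last first.
    apply: uniq_perm; rewrite ?fset_uniq ?iota_uniq// => i.
    by rewrite /J !inE.
  rewrite -prodEFin; rewrite [in RHS](big_nth false) /index_iota subn0.
  apply: eq_bigr => i _; rewrite /C; case: ifP => _.
    exact: iid_prob.
  by apply: prob_complement => //; exact: iid_prob.
have key t i : C i (X i t) <-> (X i t \in B) = nth false w i.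
  by have /seteqP[h1 h2] := preimage_in (X i) B (nth false w i);
    split; [apply: h2|apply: h1].
apply/seteqP; split => t /= H.
  apply: (@eq_from_nth _ false); rewrite size_outcomes // => i iw.
  rewrite (nth_map 0%N) ?size_iota// nth_iota// add0n; apply/key/H.
  by rewrite /= /J !inE mem_iota.
move=> i; rewrite /= /J !inE mem_iota /= => iw; apply/key.
by rewrite -[in RHS]H (nth_map 0%N) ?size_iota// nth_iota.
Qed.

(** The prefix is fixed so that the induction can run on the length of the
remaining word: splitting on the next letter extends the prefix by one. *)
Lemma prob_outcomes_prefix {d} {T : measurableType d} {R : realType}
    {P : probability T R} (X : nat -> {RV P >-> R}) (B : set R) (q : R)
    (A : pred (seq bool)) n (w : seq bool) :
  iid X -> measurable B -> P (X 0%N @^-1` B) = q%:E ->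
  P [set t | outcomes X B (size w) t = w /\ A (outcomes X B (size w + n) t)] =
  ((\prod_(b <- w) (if b then q else 1 - q)) *
   bern_mean q n (fun v => (A (w ++ v))%:R))%:E.
Proof.
move=> iX mB qB; elim: n w => [|n IHn] w.
  rewrite addn0 /= cats0; case: (boolP (A w)) => Aw; rewrite ?mulr1 ?mulr0.
    rewrite -(prob_outcomes_eq X B q w) //; congr (P _).
    by apply/seteqP; split => t /= => [[]|E] //; rewrite E.
  rewrite [X in P X](_ : _ = set0) ?measure0//.
  by apply/seteqP; split => t //= [-> /(negP Aw)].
pose D b := [set t | outcomes X B (size (rcons w b)) t = rcons w b /\
  A (outcomes X B (size (rcons w b) + n) t)].
have mD b : measurable (D b).
  rewrite [D b](_ : _ = [set t | [set u | take (size (rcons w b)) u = rcons w b /\ A u]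
     (outcomes X B (size (rcons w b) + n) t)]); first exact: measurable_outcomes.
  by apply/seteqP; split => t /=; rewrite take_outcomes ?leq_addr.
rewrite [X in P X](_ : _ = D true `|` D false); last first.
  apply/seteqP; split => t; rewrite /D /= !size_rcons !addSn addnS !outcomesS.
    by move=> [-> At]; case: (X (size w) t \in B) At => At; [left|right].
  by move=> [[/rcons_inj[-> _]]|[/rcons_inj[-> _]]].
rewrite measureU//; last first.
  apply/seteqP; split => t //=; rewrite /D /= !size_rcons => -[[-> _] [/rcons_inj[] //]].
have E b : bern_mean q n (fun v => (A (rcons w b ++ v))%:R) =
    bern_mean q n ((fun v => (A (w ++ v))%:R) \o cons b).
  by apply: bern_mean_ext => v _; rewrite cat_rcons.
have PD b : P (D b) = _ := IHn (rcons w b).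
apply: (etrans (congr2 (@GRing.add _) (PD true) (PD false))).
by rewrite -EFinD !E !big_rcons /=; congr (_%:E); ring.
Qed.

(** Reduces the probability of every event decided by the first [n] hits to a
finite computation. *)
Lemma prob_outcomes {d} {T : measurableType d} {R : realType}
    {P : probability T R} (X : nat -> {RV P >-> R}) (B : set R) (q : R)
    (A : pred (seq bool)) n :
  iid X -> measurable B -> P (X 0%N @^-1` B) = q%:E ->
  P [set t | A (outcomes X B n t)] = (bern_mean q n (fun w => (A w)%:R))%:E.
Proof.
move=> iX mB qB; have := prob_outcomes_prefix X B q A n [::] iX mB qB.
rewrite big_nil mul1r /= => <-; congr (P _).
by apply/seteqP; split => t //= -[].
Qed.

(** The drifting walk: the exceptional events have geometrically decaying
probabilities, so Borel-Cantelli applies. *)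
Lemma ae_eventually_few_hits {d} {T : measurableType d} {R : realType}
    {P : probability T R} (X : nat -> {RV P >-> R}) (B : set R) (q p : R) :
  iid X -> measurable B -> P (X 0%N @^-1` B) = q%:E -> q < p ->
  {ae P, forall t, exists N, forall n, (N <= n)%N ->
    (count id (outcomes X B n t))%:R < p * n%:R}.
Proof.
move=> iX mB qB qp.
have q01 : 0 <= q <= 1.
  rewrite -!lee_fin -qB measure_ge0 /=; apply: probability_le1.
  exact: measurable_funPTI.
have [r /andP[r0 r1] hr] := bern_mean_chernoff q p q01 qp.
pose F n := [set t | (p * n%:R <= (count id (outcomes X B n t))%:R)%R].
have mF n : measurable (F n).
  exact: (measurable_outcomes X B n [set w | p * n%:R <= (count id w)%:R]).
have PF n : (P (F n) <= (r ^+ n)%:E)%E.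
  by rewrite (prob_outcomes X B q (fun w => p * n%:R <= (count id w)%:R) n)// lee_fin.
exists (lim_sup_set F); split.
- by apply: bigcapT_measurable => k; exact: bigcup_measurable.
- apply: lim_sup_set_cvg0 => //.
  apply: (@le_lt_trans _ _ (\sum_(n <oo) (r ^+ n)%:E)%E).
    by apply: lee_nneseries => n *; [exact: measure_ge0|exact: PF].
  have gr : series (geometric 1 r) @ \oo --> 1 * (1 - r)^-1.
    by apply: cvg_geometric_series; rewrite ger0_norm.
  suff cE : (\sum_(0 <= k < n) (r ^+ k)%:E)%E @[n --> \oo] -->
      (1 * (1 - r)^-1)%:E.
    by rewrite (cvg_lim _ cE) ?ltry.
  apply: cvg_EFin; first by apply: nearW => n; rewrite sumEFin.
  rewrite [X in X @ _ --> _](_ : _ = series (geometric 1 r)) //.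
  by apply/funext => n; rewrite /= sumEFin; apply: eq_bigr => k _;
    rewrite /geometric /= mul1r.
- move=> t /= nt k _; apply: contrapT => H; apply: nt; exists k => n kn.
  by rewrite ltNge; apply/negP => h; apply: H; exists n.
Qed.

(** The centred walk: were it nonpositive from time [m] on, the walk restarted
at time [m], whose height is then between [- m] and [0], would stay nonpositive
for [N] steps for every [N]; that has arbitrarily small probability by
[stay_prob_small]. *)
Lemma ae_often_many_hits {d} {T : measurableType d} {R : realType}
    {P : probability T R} (X : nat -> {RV P >-> R}) (B : set R) (q : R) :
  iid X -> measurable B -> P (X 0%N @^-1` B) = q%:E -> 0 < q < 1 ->
  {ae P, forall t, forall m, exists2 n, (m <= n)%N &
    q * n%:R < (count id (outcomes X B n t))%:R}.
Proof.
move=> iX mB qB q01; have [q0 q1] := andP q01.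
have q01' : 0 <= q <= 1 by rewrite !ltW.
apply: ae_foralln => m.
pose A w := stays q ((count id (take m w))%:R - q * m%:R) (drop m w).
pose E N := [set t | A (outcomes X B (m + N) t)].
have mE N : measurable (E N) by exact: (measurable_outcomes X B _ [set w | A w]).
exists (\bigcap_N E N); split.
- exact: bigcapT_measurable.
- apply/eqP; rewrite eq_le measure_ge0 andbT; apply/lee_addgt0Pr => e e0.
  rewrite add0e; have [N hN] := stay_prob_small q m%:R e q01 (ler0n _ _) e0.
  apply: (@le_trans _ _ (P (E N))).
    by rewrite le_measure ?inE//; [exact: bigcapT_measurable|exact: bigcap_inf].
  rewrite (prob_outcomes X B q A _)// lee_fin bern_mean_cat.
  rewrite -[leRHS](bern_mean_cst q e m); apply: bern_mean_le => // w sw.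
  rewrite (@bern_mean_ext _ _ _ _
    (fun v => (stays q ((count id w)%:R - q * m%:R) v)%:R)); last first.
    by move=> v _; rewrite /A take_size_cat// drop_size_cat.
  have cm : (count id w)%:R <= m%:R :> R by rewrite ler_nat -sw count_size.
  case: (lerP ((count id w)%:R - q * m%:R) 0) => s0; last first.
    by rewrite [leLHS]stay_prob_pos_start // ltW.
  apply: hN; rewrite (le_trans s0)// andbT.
  have : q * m%:R <= m%:R by rewrite ler_piMl// ltW.
  have : (0:R) <= (count id w)%:R by [].
  lra.
- move=> t /= nt N _; rewrite /E /A /=; apply: staysP => k.
  rewrite size_drop size_outcomes addKn => kN.
  have mkE : outcomes X B (m + k) t =
      outcomes X B m t ++ take k (drop m (outcomes X B (m + N) t)).
    by rewrite -[in RHS](take_outcomes X B m (m + N) t) ?leq_addr// -takeD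
      take_outcomes// leq_add2l.
  rewrite leNgt; apply/negP => h; apply: nt; exists (m + k)%N; first exact: leq_addr.
  move: h; rewrite mkE count_cat !natrD take_outcomes ?leq_addr//; lra.
Qed.

(** * Infima of up-closed sets of reals *)

Lemma ereal_rat_between {R : realType} (a b : \bar R) : (a < b)%E ->
  exists r : rat, (a < (ratr r)%:E < b)%E.
Proof.
have real_between (x y : R) : x < y -> exists r : rat, x < ratr r < y.
  by move=> /rat_in_itvoo[r]; rewrite in_itv /= => xry; exists r.
case: a b => [a||] [b||] //; rewrite ?lte_fin => ab.
- by have [r] := real_between a b ab; exists r; rewrite !lte_fin.
- have [r /andP[ar _]] := real_between a (a + 1) ltac:(lra).
  by exists r; rewrite lte_fin ar ltry.
- have [r /andP[_ rb]] := real_between (b - 1) b ltac:(lra).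
  by exists r; rewrite lte_fin rb ltNyr.
- by exists 0; rewrite ltNyr ltry.
Qed.

(** Bounds tested on rationals only, so that almost sure statements at
individual points can be combined countably. *)
Lemma ereal_le_rat {R : realType} (a l : \bar R) :
  (forall r : rat, (a < (ratr r)%:E)%E -> (l <= (ratr r)%:E)%E) -> (l <= a)%E.
Proof.
move=> H; rewrite leNgt; apply/negP => /ereal_rat_between[r /andP[ar]].
by rewrite ltNge H.
Qed.

Lemma ereal_ge_rat {R : realType} (a l : \bar R) :
  (forall r : rat, ((ratr r)%:E < a)%E -> ((ratr r)%:E <= l)%E) -> (a <= l)%E.
Proof.
move=> H; rewrite leNgt; apply/negP => /ereal_rat_between[r /andP[+ ra]].
by rewrite ltNge H.
Qed.

Definition up_closed {R : realType} (S : set R) :=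
  forall x y, x <= y -> S x -> S y.

(** Both quantiles have this form, with [S] the set where the distribution
function is at least, respectively exceeds, the level; the lemmas below thus
serve for the two of them. *)
Definition inf_real {R : realType} (S : set R) : \bar R := ereal_inf (EFin @` S).

Lemma inf_real_le {R : realType} (S : set R) x : S x -> (inf_real S <= x%:E)%E.
Proof. by move=> Sx; apply: ereal_inf_lbound; exists x. Qed.

Lemma inf_real_ge {R : realType} (S : set R) x :
  up_closed S -> ~ S x -> (x%:E <= inf_real S)%E.
Proof.
move=> upS Sx; apply: le_ereal_inf_tmp => _ [y Sy <-]; rewrite lee_fin leNgt.
by apply/negP => /ltW yx; apply/Sx/(upS _ _ yx).
Qed.

Lemma lt_inf_real {R : realType} (S : set R) x : (x%:E < inf_real S)%E -> ~ S x.
Proof. by move=> xS Sx; move: xS; rewrite ltNge inf_real_le. Qed.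

Lemma inf_real_lt {R : realType} (S : set R) x :
  up_closed S -> (inf_real S < x%:E)%E -> S x.
Proof.
by move=> upS Sx; apply: contrapT => /(inf_real_ge _ _ upS); rewrite leNgt Sx.
Qed.

(** One implication is enough, [x] and [y] being interchangeable. *)
Definition constant_between {R : realType} (a b : \bar R) (S : set R) :=
  forall x y, (a < x%:E < b)%E -> (a < y%:E < b)%E -> S x -> S y.

(** A set constant on the gap contains all of it as soon as it meets it, and the
points of the gap come arbitrarily close to its lower end. *)
Lemma inf_real_le_gap {R : realType} (S : set R) (a b : \bar R) x :
  up_closed S -> constant_between a b S -> (a < x%:E < b)%E -> S x ->
  (inf_real S <= a)%E.
Proof.
move=> upS cS xab Sx; apply: ereal_le_rat => r ar; apply: inf_real_le.
have [/andP[ax xb]] := (xab, leP x (ratr r)).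
case=> [xr|rx]; first exact: upS xr Sx.
by apply: cS Sx => //; rewrite ar (lt_trans _ xb).
Qed.

(** Dually to [inf_real_le_gap], a set missing one point of the gap misses all of
it, and every point of the gap is then a lower bound of the set. *)
Lemma inf_real_ge_gap {R : realType} (S : set R) (a b : \bar R) x :
  up_closed S -> constant_between a b S -> (a < x%:E < b)%E -> ~ S x ->
  (b <= inf_real S)%E.
Proof.
move=> upS cS xab Sx; apply: ereal_ge_rat => r rb; apply: inf_real_ge => // Sr.
have [/andP[ax xb]] := (xab, leP (ratr r) x).
case=> [rx|xr]; first exact/Sx/(upS _ _ rx).
by apply/Sx/(cS _ _ _ xab Sr); rewrite rb andbT (lt_trans ax).
Qed.

(** * Upper and lower limits of extended real sequences *)

Lemma le_limn_einf {R : realType} (u : nat -> \bar R) (c : \bar R) N :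
  (forall n, (N <= n)%N -> (c <= u n)%E) -> (c <= limn_einf u)%E.
Proof.
move=> H; rewrite limn_einf_lim; apply: lime_ge; first exact: is_cvg_einfs.
by exists N => // n /= Nn; apply: le_ereal_inf_tmp => _ [k /= nk <-]; apply: H;
  exact: leq_trans nk.
Qed.

Lemma limn_esup_le {R : realType} (u : nat -> \bar R) (c : \bar R) N :
  (forall n, (N <= n)%N -> (u n <= c)%E) -> (limn_esup u <= c)%E.
Proof.
move=> H; rewrite limn_esup_lim; apply: lime_le; first exact: is_cvg_esups.
by exists N => // n /= Nn; apply: ge_ereal_sup => _ [k /= nk <-]; apply: H;
  exact: leq_trans nk.
Qed.

Lemma limn_einf_le {R : realType} (u : nat -> \bar R) (c : \bar R) :
  (forall m, exists2 n, (m <= n)%N & (u n <= c)%E) -> (limn_einf u <= c)%E.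
Proof.
move=> H; rewrite limn_einf_lim; apply: lime_le; first exact: is_cvg_einfs.
apply: nearW => m; have [n mn un] := H m.
by apply: le_trans un; apply: ereal_inf_lbound; exists n.
Qed.

Lemma le_limn_esup {R : realType} (u : nat -> \bar R) (c : \bar R) :
  (forall m, exists2 n, (m <= n)%N & (c <= u n)%E) -> (c <= limn_esup u)%E.
Proof.
move=> H; rewrite limn_esup_lim; apply: lime_ge; first exact: is_cvg_esups.
apply: nearW => m; have [n mn un] := H m.
by apply: (le_trans un); apply: ereal_sup_ubound; exists n.
Qed.

Lemma limn_einf_esup_cvg {R : realType} (u : nat -> \bar R) (l : \bar R) :
  limn_einf u = l -> limn_esup u = l -> u n @[n --> \oo] --> l.
Proof.
move=> infl supl; apply: (@squeeze_cvge _ _ _ _ (einfs u) _ (esups u)).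
- apply: nearW => n; rewrite ereal_inf_lbound ?ereal_sup_ubound//; by exists n => /=.
- by rewrite -infl limn_einf_lim; exact: is_cvg_einfs.
- by rewrite -supl limn_esup_lim; exact: is_cvg_esups.
Qed.

Lemma ae_forall_countable {d} {T : measurableType d} {R : realType}
    (mu : {measure set T -> \bar R}) (I : countType) (Q : I -> T -> Prop) :
  (forall i, {ae mu, forall t, Q i t}) -> {ae mu, forall t, forall i, Q i t}.
Proof.
move=> H; have : {ae mu, forall t, forall n,
    if @choice.unpickle I n is Some i then Q i t else True}.
  apply: ae_foralln => n; case: choice.unpickle => [i|]; first exact: H.
  exact: aeW.
by apply: filterS => t Ht i; have := Ht (choice.pickle i); rewrite choice.pickleK.
Qed.

(** * Sign of the deviation of the empirical distribution function *)

Lemma empirical_cdfE {d} {T : measurableType d} {R : realType}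
    {P : probability T R} (X : nat -> {RV P >-> R}) n t x :
  empirical_cdf X n t x =
  ((count id (outcomes X [set` `]-oo, x]] n t))%:R / n%:R)%:E.
Proof.
rewrite /empirical_cdf; congr (_%:R / _)%:E.
rewrite /outcomes count_map -sum1_count -[n in iota 0 n]subn0 big_mkord.
rewrite cardsE -sum1_card; apply: eq_bigl => i /=.
by rewrite mem_setE in_itv.
Qed.

Lemma empirical_cdf_lt {d} {T : measurableType d} {R : realType}
    {P : probability T R} (X : nat -> {RV P >-> R}) n t x (p : R) : (0 < n)%N ->
  (empirical_cdf X n t x < p%:E)%E =
  ((count id (outcomes X [set` `]-oo, x]] n t))%:R < p * n%:R).
Proof. by move=> n0; rewrite empirical_cdfE lte_fin ltr_pdivrMr ?ltr0n. Qed.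

Lemma count_outcomesC {T : Type} {R : realType} (X : nat -> T -> R) (B : set R) n t :
  (count id (outcomes X B n t) + count id (outcomes X (~` B) n t) = n)%N.
Proof.
rewrite -[RHS](size_iota 0) !count_map -(count_predC (fun i => X i t \in B)).
congr (_ + _)%N; apply: eq_count => i /=.
by apply/idP/idP; rewrite notin_setE => /[!inE].
Qed.

Lemma empirical_cdf_gt {d} {T : measurableType d} {R : realType}
    {P : probability T R} (X : nat -> {RV P >-> R}) n t x (p : R) : (0 < n)%N ->
  (p%:E < empirical_cdf X n t x)%E =
  ((count id (outcomes X (~` [set` `]-oo, x]]) n t))%:R < (1 - p) * n%:R).
Proof.
move=> n0; rewrite empirical_cdfE lte_fin ltr_pdivlMr ?ltr0n//.
have := count_outcomesC X [set` `]-oo, x]] n t.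
move=> /(congr1 (fun k => k%:R : R)); rewrite natrD => nE.
by apply/idP/idP => h; lra.
Qed.

Lemma empirical_cdf_le1 {d} {T : measurableType d} {R : realType}
    {P : probability T R} (X : nat -> {RV P >-> R}) n t x :
  (0 < n)%N -> (empirical_cdf X n t x <= 1%:E)%E.
Proof.
move=> n0; rewrite leNgt empirical_cdf_gt// subrr mul0r; apply/negP.
by rewrite ltNge ler0n.
Qed.

Lemma empirical_cdf_nondecreasing {d} {T : measurableType d} {R : realType}
    {P : probability T R} (X : nat -> {RV P >-> R}) n t x y :
  x <= y -> (empirical_cdf X n t x <= empirical_cdf X n t y)%E.
Proof.
move=> xy; rewrite lee_fin ler_wpM2r ?invr_ge0 ?ler0n// ler_nat.
apply: subset_leq_card; apply/fintype.subsetP => i.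
by rewrite !finset.inE => /le_trans; apply.
Qed.

Lemma cdf_EFin {d} {T : measurableType d} {R : realType}
    {P : probability T R} (Y : {RV P >-> R}) x :
  P (Y @^-1` [set` `]-oo, x]]) = (fine (cdf Y x))%:E.
Proof. by rewrite fineK// fin_num_measure. Qed.

Lemma ae_empirical_cdf_lt {d} {T : measurableType d} {R : realType}
    {P : probability T R} (X : nat -> {RV P >-> R}) x (p : R) :
  iid X -> (cdf (X 0%N) x < p%:E)%E ->
  {ae P, forall t, exists N, forall n, (N <= n)%N ->
    (empirical_cdf X n t x < p%:E)%E}.
Proof.
move=> iX Fp; pose B := [set` `]-oo, x]] : set R.
have mB : measurable B by exact: measurable_itv.
have qp : fine (cdf (X 0%N) x) < p by rewrite -lte_fin -cdf_EFin.
apply: filterS (ae_eventually_few_hits X B _ _ iX mB (cdf_EFin _ _) qp) => t [N H].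
exists N.+1 => n Nn; have n0 : (0 < n)%N by exact: leq_trans Nn.
rewrite empirical_cdf_lt//; apply: H; exact: ltnW.
Qed.

Lemma ae_empirical_cdf_gt {d} {T : measurableType d} {R : realType}
    {P : probability T R} (X : nat -> {RV P >-> R}) x (p : R) :
  iid X -> (p%:E < cdf (X 0%N) x)%E ->
  {ae P, forall t, exists N, forall n, (N <= n)%N ->
    (p%:E < empirical_cdf X n t x)%E}.
Proof.
move=> iX pF; pose B := [set` `]-oo, x]] : set R.
have mB : measurable B by exact: measurable_itv.
have mC : measurable (~` B) by exact: measurableC.
have qp : 1 - fine (cdf (X 0%N) x) < 1 - p.
  by rewrite ltrD2l ltrN2 -lte_fin -cdf_EFin.
have qC := prob_complement _ _ _ mB (cdf_EFin (X 0%N) x).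
apply: filterS (ae_eventually_few_hits X (~` B) _ _ iX mC qC qp) => t [N H].
exists N.+1 => n Nn; have n0 : (0 < n)%N by exact: leq_trans Nn.
rewrite empirical_cdf_gt//; apply: H; exact: ltnW.
Qed.

Lemma ae_empirical_cdf_often_gt {d} {T : measurableType d} {R : realType}
    {P : probability T R} (X : nat -> {RV P >-> R}) x (p : R) :
  iid X -> 0 < p < 1 -> cdf (X 0%N) x = p%:E ->
  {ae P, forall t, forall m, exists2 n, (m <= n)%N &
    (p%:E < empirical_cdf X n t x)%E}.
Proof.
move=> iX p01 Fp; pose B := [set` `]-oo, x]] : set R.
have mB : measurable B by exact: measurable_itv.
apply: filterS (ae_often_many_hits X B p iX mB Fp p01) => t H m.
have [n mn hn] := H m.+1; exists n; first exact: ltnW.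
have n0 : (0 < n)%N by exact: leq_trans mn.
by rewrite empirical_cdfE lte_fin ltr_pdivlMr ?ltr0n.
Qed.

Lemma ae_empirical_cdf_often_lt {d} {T : measurableType d} {R : realType}
    {P : probability T R} (X : nat -> {RV P >-> R}) x (p : R) :
  iid X -> 0 < p < 1 -> cdf (X 0%N) x = p%:E ->
  {ae P, forall t, forall m, exists2 n, (m <= n)%N &
    (empirical_cdf X n t x < p%:E)%E}.
Proof.
move=> iX p01 Fp; pose B := [set` `]-oo, x]] : set R.
have mB : measurable B by exact: measurable_itv.
have mC : measurable (~` B) by exact: measurableC.
have qC := prob_complement _ _ _ mB Fp.
have q01 : 0 < 1 - p < 1 by move: p01; lra.
apply: filterS (ae_often_many_hits X (~` B) (1 - p) iX mC qC q01) => t H m.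
have [n mn hn] := H m.+1; exists n; first exact: ltnW.
have n0 : (0 < n)%N by exact: leq_trans mn.
rewrite empirical_cdf_lt//.
have := count_outcomesC X B n t.
by move=> /(congr1 (fun k => k%:R : R)); rewrite natrD => nE; lra.
Qed.

Lemma ae_never_in_null {d} {T : measurableType d} {R : realType}
    {P : probability T R} (X : nat -> {RV P >-> R}) (B : set R) :
  iid X -> measurable B -> P (X 0%N @^-1` B) = 0%:E ->
  {ae P, forall t, forall i, ~ B (X i t)}.
Proof.
move=> iX mB B0; apply: ae_foralln => i.
exists (X i @^-1` B); split; first exact: measurable_funPTI.
  exact: (iid_prob X B 0 i iX mB B0).
by move=> t /= /contrapT.
Qed.

Lemma count_outcomes_never {T : Type} {R : realType} (X : nat -> T -> R) (B : set R)
    n t :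
  (forall i, ~ B (X i t)) -> count id (outcomes X B n t) = 0%N.
Proof.
move=> H; rewrite count_map; apply/eqP; rewrite -leqn0 leqNgt -has_count.
by apply/hasP => -[i _ /set_mem]; exact: H.
Qed.

(** For [p = 0] no observation is at most [x], and for [p = 1] the bound is
trivial; otherwise the strict inequality already occurs infinitely often. *)
Lemma ae_empirical_cdf_often_le {d} {T : measurableType d} {R : realType}
    {P : probability T R} (X : nat -> {RV P >-> R}) x (p : R) :
  iid X -> 0 <= p <= 1 -> cdf (X 0%N) x = p%:E ->
  {ae P, forall t, forall m, exists2 n, (m <= n)%N &
    (empirical_cdf X n t x <= p%:E)%E}.
Proof.
move=> iX /andP[p0 p1] Fp.
have [pp|pp|pE] := ltgtP p 1; last 2 first.
- by move: p1; rewrite leNgt pp.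
- apply: aeW => t m; exists m.+1 => //; rewrite pE; exact: empirical_cdf_le1.
have [pn|pn|pE] := ltgtP p 0.
- by move: p0; rewrite leNgt pn.
- apply: filterS (ae_empirical_cdf_often_lt X x p iX _ Fp) => [t H m|].
    by have [n mn /ltW] := H m; exists n.
  by rewrite pn.
- have B0 : P (X 0%N @^-1` [set` `]-oo, x]]) = 0%:E by rewrite -pE.
  apply: filterS (ae_never_in_null X _ iX (measurable_itv _) B0) => t H m.
  exists m => //.
  by rewrite empirical_cdfE count_outcomes_never// mul0r pE.
Qed.

Lemma ae_empirical_cdf_often_ge {d} {T : measurableType d} {R : realType}
    {P : probability T R} (X : nat -> {RV P >-> R}) x (p : R) :
  iid X -> 0 <= p <= 1 -> cdf (X 0%N) x = p%:E ->
  {ae P, forall t, forall m, exists2 n, (m <= n)%N &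
    (p%:E <= empirical_cdf X n t x)%E}.
Proof.
move=> iX /andP[p0 p1] Fp.
have [pn|pn|pE] := ltgtP p 0.
- by move: p0; rewrite leNgt pn.
- have [pp|pp|pE] := ltgtP p 1.
  + apply: filterS (ae_empirical_cdf_often_gt X x p iX _ Fp) => [t H m|].
      by have [n mn /ltW] := H m; exists n.
    by rewrite pn.
  + by move: p1; rewrite leNgt pp.
  + have mB := measurable_itv `]-oo, x].
    have B0 : P (X 0%N @^-1` (~` [set` `]-oo, x]])) = 0%:E.
      by rewrite (prob_complement _ _ _ mB Fp) pE subrr.
    apply: filterS (ae_never_in_null X _ iX (measurableC mB) B0) => t H m.
    exists m.+1 => //.
    have := count_outcomesC X [set` `]-oo, x]] m.+1 t.
    rewrite (count_outcomes_never X _ _ _ H) addn0 empirical_cdfE => ->.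
    by rewrite divff ?pnatr_eq0// pE.
- apply: aeW => t m; exists m => //.
  by rewrite pE empirical_cdfE lee_fin divr_ge0.
Qed.

(** A flat piece of the distribution function carries no mass; the open gap is
a countable union of half-open intervals with rational endpoints inside it. *)
Lemma ae_sample_avoids_gap {d} {T : measurableType d} {R : realType}
    {P : probability T R} (X : nat -> {RV P >-> R}) (a b : \bar R) (p : R) :
  iid X -> (forall x, (a < x%:E < b)%E -> cdf (X 0%N) x = p%:E) ->
  {ae P, forall t, forall i, ~~ (a < (X i t)%:E < b)%E}.
Proof.
move=> iX Fab.
pose inR (r : rat) := (a < (ratr r)%:E < b)%E.
suff : {ae P, forall t, forall rs : rat * rat, inR rs.1 -> inR rs.2 ->
    forall i, ~ (`]-oo, ratr rs.2] `\` `]-oo, ratr rs.1] : set R) (X i t)}.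
  apply: filterS => t H i; apply/negP => /andP[aX Xb].
  have [r /andP[ar rX]] := ereal_rat_between _ _ aX.
  have [s /andP[Xs sb]] := ereal_rat_between _ _ Xb.
  apply: (H (r, s) _ _ i); rewrite /inR /=.
  - by rewrite ar (lt_trans rX).
  - by rewrite sb andbT (lt_trans aX).
  - rewrite !in_itv /=; split; first by rewrite -lee_fin ltW.
    by apply/negP; rewrite -ltNge -lte_fin.
apply: (ae_forall_countable P) => -[r s] /=.
have [rab|] := boolP (inR r); last by move=> _; apply: aeW.
have [sab|] := boolP (inR s); last by move=> _; apply: aeW.
have mr := measurable_itv `]-oo, ratr r : R].
have ms := measurable_itv `]-oo, ratr s : R].
apply: filterS (ae_never_in_null X _ iX (measurableD ms mr) _).
  by move=> t H _ _.
have [rs|sr] := leP (ratr r : R) (ratr s); last first.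
  rewrite (_ : _ @^-1` _ = set0) ?measure0//; apply/seteqP; split => t //=.
  by rewrite !in_itv /= => -[Xs]; apply; apply: (le_trans Xs); exact: ltW.
pose D (q : rat) := X 0%N @^-1` [set` `]-oo, ratr q : R]].
have PD q : inR q -> P (D q) = p%:E by move=> qab; rewrite -(Fab (ratr q)).
rewrite (_ : _ @^-1` _ = D s `\` D r) //.
have mD q : measurable (D q) by exact: measurable_funPTI.
rewrite measureD//; last by rewrite -ge0_fin_numE ?fin_num_measure.
rewrite (setIidr _ : D s `&` D r = D r).
  apply: (etrans (congr2 (fun u v => u - v)%E (PD s sab) (PD r rab))).
  by rewrite subee.
by move=> t; rewrite /D /= !in_itv /= => /le_trans; exact.
Qed.

Lemma empirical_cdf_gap {d} {T : measurableType d} {R : realType}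
    {P : probability T R} (X : nat -> {RV P >-> R}) (a b : \bar R) n t x y :
  (forall i, ~~ (a < (X i t)%:E < b)%E) ->
  (a < x%:E < b)%E -> (a < y%:E < b)%E ->
  empirical_cdf X n t x = empirical_cdf X n t y.
Proof.
move=> H /andP[ax xb] /andP[ay yb]; rewrite /empirical_cdf; congr (_%:R / _)%:E.
apply: eq_card => i; rewrite !finset.inE.
have /nandP[|] := H i; rewrite -leNgt => h.
  by rewrite -!lee_fin !(le_trans h) ?ltW.
by rewrite -!lee_fin !leNgt !(lt_le_trans _ h).
Qed.
(** * Almost sure behaviour of the sample quantiles *)

Lemma up_closed_superlevel {R : realType} (G : R -> \bar R) (p : R) :
  {homo G : x y / x <= y >-> (x <= y)%E} ->
  up_closed [set x | (p%:E <= G x)%E] /\ up_closed [set x | (p%:E < G x)%E].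
Proof.
by move=> hG; split=> x y /hG xy /= px; [apply: le_trans xy|apply: lt_le_trans xy].
Qed.

Lemma lq_le_rq {R : realType} (G : R -> \bar R) (p : R) : (lq G p <= rq G p)%E.
Proof. by apply: ereal_inf_le_tmp => _ [x /ltW px <-]; exists x. Qed.

(** If [r] is rational with [c < r < lq F p] then [F r < p], hence eventually
[Fn r < p], hence the sample quantile is at least [r]. *)
Lemma ae_lt_lq {d} {T : measurableType d} {R : realType}
    {P : probability T R} (X : nat -> {RV P >-> R}) (p : R) : iid X ->
  {ae P, forall t, forall c : \bar R, (c < lq (cdf (X 0%N)) p)%E ->
    exists N, forall n, (N <= n)%N -> (c < lq (empirical_cdf X n t) p)%E}.
Proof.
move=> iX.
suff : {ae P, forall t, forall r : rat, (cdf (X 0%N) (ratr r) < p%:E)%E ->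
    exists N, forall n, (N <= n)%N -> (empirical_cdf X n t (ratr r) < p%:E)%E}.
  apply: filterS => t H c /ereal_rat_between[r /andP[cr /lt_inf_real /= /negP]].
  rewrite -ltNge => /H[N HN]; exists N => n /HN rp; apply: (lt_le_trans cr).
  apply: inf_real_ge; last by apply/negP; rewrite -ltNge.
  by apply: (up_closed_superlevel _ p _).1; exact: empirical_cdf_nondecreasing.
apply: (ae_forall_countable P) => r.
have [Fp|_] := boolP (_ < _)%E; last exact: aeW.
by apply: filterS (ae_empirical_cdf_lt X _ p iX Fp).
Qed.

Lemma ae_gt_rq {d} {T : measurableType d} {R : realType}
    {P : probability T R} (X : nat -> {RV P >-> R}) (p : R) : iid X ->
  {ae P, forall t, forall c : \bar R, (rq (cdf (X 0%N)) p < c)%E ->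
    exists N, forall n, (N <= n)%N -> (rq (empirical_cdf X n t) p < c)%E}.
Proof.
move=> iX.
suff : {ae P, forall t, forall r : rat, (p%:E < cdf (X 0%N) (ratr r))%E ->
    exists N, forall n, (N <= n)%N -> (p%:E < empirical_cdf X n t (ratr r))%E}.
  apply: filterS => t H c /ereal_rat_between[r /andP[+ rc]].
  move=> /(inf_real_lt _ _ (up_closed_superlevel _ p (cdf_nondecreasing (X 0%N))).2) /H[N HN].
  by exists N => n /HN pr; apply: le_lt_trans rc; exact: inf_real_le.
apply: (ae_forall_countable P) => r.
have [Fp|_] := boolP (_ < _)%E; last exact: aeW.
by apply: filterS (ae_empirical_cdf_gt X _ p iX Fp).
Qed.

Lemma cdf_between_quantiles {d} {T : measurableType d} {R : realType}
    {P : probability T R} (Y : {RV P >-> R}) (p : R) x :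
  (lq (cdf Y) p < x%:E < rq (cdf Y) p)%E -> cdf Y x = p%:E.
Proof.
have [upl _] := up_closed_superlevel _ p (cdf_nondecreasing Y).
move=> /andP[/(inf_real_lt _ _ upl) /= px /lt_inf_real /= /negP].
by rewrite -leNgt => xp; apply/eqP; rewrite eq_le xp px.
Qed.

(** Only the comparison of the empirical distribution function with [p] at the
single point [x] of the gap decides on which side the sample quantiles lie. *)
Lemma ae_quantiles_avoid_gap {d} {T : measurableType d} {R : realType}
    {P : probability T R} (X : nat -> {RV P >-> R}) (p x : R) : iid X ->
  let a := lq (cdf (X 0%N)) p in let b := rq (cdf (X 0%N)) p in
  (a < x%:E < b)%E ->
  {ae P, forall t, forall n, let G := empirical_cdf X n t in
    [/\ (p%:E <= G x -> lq G p <= a)%E, (G x < p%:E -> b <= lq G p)%E,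
        (p%:E < G x -> rq G p <= a)%E & (G x <= p%:E -> b <= rq G p)%E]}.
Proof.
move=> iX a b xab.
apply: filterS (ae_sample_avoids_gap X a b p iX (fun x => cdf_between_quantiles _ p x)).
move=> t H n; pose G := empirical_cdf X n t.
have Gc y z := empirical_cdf_gap X a b n t y z H.
have [upl upr] := up_closed_superlevel G p (empirical_cdf_nondecreasing X n t).
have cl : constant_between a b [set y | (p%:E <= G y)%E].
  by move=> y z yab zab /=; rewrite /G (Gc y z).
have cr : constant_between a b [set y | (p%:E < G y)%E].
  by move=> y z yab zab /=; rewrite /G (Gc y z).
split=> h.
- exact: (inf_real_le_gap _ a b x upl).
- by apply: (inf_real_ge_gap _ a b x upl) => //=; apply/negP; rewrite -ltNge.
- exact: (inf_real_le_gap _ a b x upr).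
- by apply: (inf_real_ge_gap _ a b x upr) => //=; apply/negP; rewrite -leNgt.
Qed.

(** The far sides of the windows are enforced by the drift, and the near sides
by the absence of observations in the gap.  An infinite end of the gap absorbs
the width [e], and a sample quantile on that side is then equal to it. *)
Lemma ae_quantile_windows {d} {T : measurableType d} {R : realType}
    {P : probability T R} (X : nat -> {RV P >-> R}) (p : R) : iid X ->
  let a := lq (cdf (X 0%N)) p in let b := rq (cdf (X 0%N)) p in
  (a < b)%E ->
  {ae P, forall t, forall e : R, 0 < e ->
    exists N : nat, forall n : nat, (N < n)%N ->
      (left_window a e `|` right_window b e) (lq (empirical_cdf X n t) p) /\
      (left_window a e `|` right_window b e) (rq (empirical_cdf X n t) p)}.
Proof.
move=> iX a b ab; have [r xab] := ereal_rat_between _ _ ab.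
apply: filterS3 (ae_quantiles_avoid_gap X p (ratr r) iX xab) (ae_lt_lq X p iX)
  (ae_gt_rq X p iX) => t avoid above below e e0.
have [N1 HN1] : exists N, forall n, (N <= n)%N ->
    a = -oo%E \/ (a - e%:E < lq (empirical_cdf X n t) p)%E.
  have [->|aNy] := eqVneq a -oo%E; first by exists 0%N => n _; left.
  have afin : a \is a fin_num by rewrite fin_numE aNy /= lt_eqF//
    (lt_le_trans ab) ?leey.
  have [|N HN] := above (a - e%:E)%E; first by rewrite lteBlDr // lteDl.
  by exists N => n /HN ?; right.
have [N2 HN2] : exists N, forall n, (N <= n)%N ->
    b = +oo%E \/ (rq (empirical_cdf X n t) p < b + e%:E)%E.
  have [->|bNy] := eqVneq b +oo%E; first by exists 0%N => n _; left.
  have bfin : b \is a fin_num by rewrite fin_numE bNy andbT gt_eqF//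
    (le_lt_trans _ ab) ?leNye.
  have [|N HN] := below (b + e%:E)%E; first by rewrite lteDl.
  by exists N => n /HN ?; right.
exists (maxn N1 N2) => n /ltnW; rewrite geq_max => /andP[/HN1 lown /HN2 upn].
have lr := lq_le_rq (empirical_cdf X n t) p.
have win v : (v <= a \/ b <= v)%E -> (lq (empirical_cdf X n t) p <= v)%E ->
    (v <= rq (empirical_cdf X n t) p)%E -> (left_window a e `|` right_window b e) v.
  move=> [va|bv] lv vr; [left|right].
  - case: lown => [aE|alq]; first by right; apply/eqP; rewrite eq_le va aE leNye.
    by left; rewrite /= in_itv /= va andbT (lt_le_trans alq).
  - case: upn => [bE|rqb]; first by right; apply/eqP; rewrite eq_le bv bE leey.
    by left; rewrite /= in_itv /= bv (le_lt_trans vr).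
have [h1 h2 h3 h4] := avoid n.
split; apply: win => //.
- by have [/h1|/h2] := leP p%:E (empirical_cdf X n t (ratr r)); [left|right].
- by have [/h4|/h3] := leP (empirical_cdf X n t (ratr r)) p%:E; [right|left].
Qed.

(** The drift confines the upper and lower limits between [a] and [b].  If
[a < b], the weak inequalities occurring infinitely often put [rq] above the gap and [lq]
below it, while the strict ones, available for [0 < p < 1], put [lq] above and
[rq] below. *)
Lemma ae_quantile_limits {d} {T : measurableType d} {R : realType}
    {P : probability T R} (X : nat -> {RV P >-> R}) (p : R) :
  iid X -> 0 <= p <= 1 ->
  let a := lq (cdf (X 0%N)) p in let b := rq (cdf (X 0%N)) p in
  {ae P, forall t,
    let lqn n := lq (empirical_cdf X n t) p in
    let rqn n := rq (empirical_cdf X n t) p in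
    [/\ limn_esup rqn = b, limn_einf lqn = a &
        0 < p < 1 \/ a = b -> limn_esup lqn = b /\ limn_einf rqn = a]}.
Proof.
move=> iX p01 a b.
have ab : (a <= b)%E by exact: lq_le_rq.
have outer : {ae P, forall t,
    let lqn n := lq (empirical_cdf X n t) p in
    let rqn n := rq (empirical_cdf X n t) p in
    [/\ (a <= limn_einf lqn)%E, (a <= limn_einf rqn)%E,
        (limn_esup lqn <= b)%E & (limn_esup rqn <= b)%E]}.
  apply: filterS2 (ae_lt_lq X p iX) (ae_gt_rq X p iX) => t above below lqn rqn.
  have lr n : (lqn n <= rqn n)%E by exact: lq_le_rq.
  split.
  - apply: ereal_ge_rat => r /above[N HN].
    by apply: (le_limn_einf _ _ N) => n /HN /ltW.
  - apply: ereal_ge_rat => r /above[N HN].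
    apply: (le_limn_einf _ _ N) => n /HN /ltW rl. exact: le_trans rl (lr n).
  - apply: ereal_le_rat => r /below[N HN].
    by apply: (limn_esup_le _ _ N) => n /HN /ltW; exact: le_trans (lr n).
  - apply: ereal_le_rat => r /below[N HN].
    by apply: (limn_esup_le _ _ N) => n /HN /ltW.
have [abE|nab] := eqVneq a b.
  apply: filterS outer => t [al ar lb rb].
  pose lqn n := lq (empirical_cdf X n t) p; pose rqn n := rq (empirical_cdf X n t) p.
  have := limn_einf_sup lqn; have := limn_einf_sup rqn.
  rewrite -abE in lb rb * => rr ll.
  have sr := le_trans ar rr; have il := le_trans ll lb.
  have sl := le_trans al ll; have ir := le_trans rr rb.
  split=> [||_]; last split; apply: le_anti.
  - by rewrite rb sr.
  - by rewrite il al.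
  - by rewrite lb sl.
  - by rewrite ir ar.
have {nab}ab' : (a < b)%E by rewrite lt_neqAle nab.
have [r xab] := ereal_rat_between _ _ ab'.
have Fr := cdf_between_quantiles (X 0%N) p _ xab.
have strict : {ae P, forall t, 0 < p < 1 ->
    (forall m, exists2 n, (m <= n)%N & (p%:E < empirical_cdf X n t (ratr r))%E) /\
    (forall m, exists2 n, (m <= n)%N & (empirical_cdf X n t (ratr r) < p%:E)%E)}.
  have [pp|_] := boolP (0 < p < 1); last exact: aeW.
  apply: filterS2 (ae_empirical_cdf_often_gt X _ p iX pp Fr)
    (ae_empirical_cdf_often_lt X _ p iX pp Fr) => t H1 H2 _; by split.
have weak : {ae P, forall t,
    (forall m, exists2 n, (m <= n)%N & (p%:E <= empirical_cdf X n t (ratr r))%E) /\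
    (forall m, exists2 n, (m <= n)%N & (empirical_cdf X n t (ratr r) <= p%:E)%E)}.
  apply: filterS2 (ae_empirical_cdf_often_ge X _ p iX p01 Fr)
    (ae_empirical_cdf_often_le X _ p iX p01 Fr) => t H1 H2; by split.
apply: filterS2 (ae_quantiles_avoid_gap X p (ratr r) iX xab)
  (filterI outer (filterI strict weak)) => t gap [[al ar lb rb] [hs [wge wle]]].
split.
- apply/eqP; rewrite eq_le rb; apply: le_limn_esup => m.
  by have [n mn h] := wle m; exists n => //; have [_ _ _] := gap n; apply.
- apply/eqP; rewrite eq_le al andbT; apply: limn_einf_le => m.
  by have [n mn h] := wge m; exists n => //; have [+ _ _ _] := gap n; apply.
- move=> [/hs[sgt slt]|abE]; last by move: ab'; rewrite abE ltxx.
  split; apply/eqP; rewrite eq_le ?lb ?ar ?andbT /=.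
  + apply: le_limn_esup => m.
    by have [n mn h] := slt m; exists n => //; have [_ + _ _] := gap n; apply.
  + apply: limn_einf_le => m.
    by have [n mn h] := sgt m; exists n => //; have [_ _ + _] := gap n; apply.
Qed.

Theorem theorem2p5 (d : measure_display) (T : measurableType d) (R : realType)
    (P : probability T R) (X : nat -> {RV P >-> R}) (p : R)
    (hX : iid X) (hp : 0 <= p <= 1) :
  let F : R -> \bar R := cdf (X 0%N) in
  let lqn (t : T) (n : nat) : \bar R := lq (empirical_cdf X n t) p in
  let rqn (t : T) (n : nat) : \bar R := rq (empirical_cdf X n t) p in
  (* (a) *)
  (rq F p = lq F p ->
    {ae P, forall t, rqn t n @[n --> \oo] --> rq F p} /\
    {ae P, forall t, lqn t n @[n --> \oo] --> lq F p}) /\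
  (* (b); at p = 0 and p = 1 both sequences converge *)
  (0 < p < 1 -> (lq F p < rq F p)%E ->
    {ae P, forall t, ~ cvgn (rqn t)} /\
    {ae P, forall t, ~ cvgn (lqn t)}) /\
  (* (c) *)
  ((lq F p < rq F p)%E ->
    {ae P, forall t, forall e : R, 0 < e ->
      exists N : nat, forall n : nat, (N < n)%N ->
        (left_window (lq F p) e `|` right_window (rq F p) e) (lqn t n) /\
        (left_window (lq F p) e `|` right_window (rq F p) e) (rqn t n)}) /\
  (* (d); at p = 0 and p = 1 the last two equalities fail if lq F p < rq F p *)
  {ae P, forall t,
    [/\ limn_esup (rqn t) = rq F p,
        limn_einf (lqn t) = lq F p &
        0 < p < 1 \/ lq F p = rq F p ->
          limn_esup (lqn t) = rq F p /\ limn_einf (rqn t) = lq F p]}.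
Proof.
move=> F lqn rqn.
have limits := ae_quantile_limits X p hX hp.
split; first last.
  split.
    move=> p01 ab; split; apply: filterS limits
      => t [rs li /(_ (or_introl p01))[ls ri]].
    - by move=> /cvg_ex[l /cvg_limn_einf_sup[il sl]]; move: ab;
      rewrite -rs -ri il sl ltxx.
    - by move=> /cvg_ex[l /cvg_limn_einf_sup[il sl]]; move: ab;
      rewrite -ls -li il sl ltxx.
  by split; [exact: ae_quantile_windows|exact: limits].
move=> ba; split; apply: filterS limits => t [rs li /(_ (or_intror (esym ba)))[ls ri]].
- by apply: limn_einf_esup_cvg => //; rewrite ba.
- by apply: limn_einf_esup_cvg => //; rewrite ls.
Qed.
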